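(* Let $\mathcal{U}$ be a subcategory of $\mathcal{G}$. The following are equivalent: (a) $\mathcal{U}$ is a groupoid; (b) the abelian category $\mathcal{A}\mathcal{U}$ is split; (c) the abelian category $\mathcal{A}\mathcal{U}$ is semisimple.
   Context: Fix a field $k$ of characteristic zero. $\mathcal{G}$ is the category whose objects are finite groups and whose morphisms are conjugacy classes of surjective group homomorphisms. A subcategory of $\mathcal{G}$ is always full and replete. For $\mathcal{U}\le\mathcal{G}$, $\mathcal{A}\mathcal{U}=[\mathcal{U}^{\mathrm{op}},\mathrm{Vect}_k]$. $\mathcal{U}$ is a groupoid if all morphisms in $\mathcal{U}$ are isomorphisms. An object is simple if its only subobjects are $0$ and itself (and it is nonzero); an object is semisimple if it is a sum of simple objects; $\mathcal{A}\mathcal{U}$ is semisimple if every object is semisimple. $\mathcal{A}\mathcal{U}$ is split if every short exact sequence in $\mathcal{A}\mathcal{U}$ splits. *)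

(* Defs.v *)
From HB Require Import structures.
From mathcomp Require Import all_boot all_order all_algebra all_fingroup.
From mathcomp Require Import boolp.

Set Implicit Arguments.
Unset Strict Implicit.
Unset Printing Implicit Defensive.

Import GRing.Theory.

(* Morphisms are compared with Leibniz equality, and [comp g f] is "g after f". *)
Record category := Category {
  ob :> Type;
  hom : ob -> ob -> Type;
  idm : forall a, hom a a;
  comp : forall a b d, hom b d -> hom a b -> hom a d;
  comp1m : forall a b (f : hom a b), comp (idm b) f = f;
  compm1 : forall a b (f : hom a b), comp f (idm a) = f;
  compA : forall a b c d (h : hom c d) (g : hom b c) (f : hom a b),
    comp h (comp g f) = comp (comp h g) f }.

Arguments hom {_} _ _.
Arguments idm {_} a.
Arguments comp {_ a b d} g f.

Declare Scope cat_scope.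
Delimit Scope cat_scope with cat.
Local Open Scope cat_scope.
Notation "g ∘ f" := (comp g f) (at level 40, left associativity) : cat_scope.

Section Basic.
Variable C : category.
Implicit Types a b c x : C.

Definition is_iso a b (f : hom a b) : Prop :=
  exists g : hom b a, g ∘ f = idm a /\ f ∘ g = idm b.

Definition isomorphic a b : Prop := exists f : hom a b, is_iso f.

Definition is_groupoid : Prop := forall a b (f : hom a b), is_iso f.

Definition is_mono a b (m : hom a b) : Prop :=
  forall t (u v : hom t a), m ∘ u = m ∘ v -> u = v.

Definition is_zero a : Prop :=
  (forall b, exists! f : hom a b, True) /\ (forall b, exists! f : hom b a, True).

Definition is_zero_mor a b (f : hom a b) : Prop :=
  exists z, is_zero z /\ exists (p : hom a z) (i : hom z b), f = i ∘ p.

Definition is_kernel a b c (i : hom a b) (p : hom b c) : Prop :=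
  is_zero_mor (p ∘ i) /\
  forall t (f : hom t b), is_zero_mor (p ∘ f) ->
    exists! u : hom t a, i ∘ u = f.

Definition is_cokernel a b c (i : hom a b) (p : hom b c) : Prop :=
  is_zero_mor (p ∘ i) /\
  forall t (f : hom b t), is_zero_mor (f ∘ i) ->
    exists! u : hom c t, u ∘ p = f.

Definition short_exact a b c (i : hom a b) (p : hom b c) : Prop :=
  is_kernel i p /\ is_cokernel i p.

Definition is_split : Prop :=
  forall a b c (i : hom a b) (p : hom b c), short_exact i p ->
    exists s : hom c b, p ∘ s = idm c.

Definition is_simple x : Prop :=
  ~ is_zero x /\
  forall a (m : hom a x), is_mono m -> is_zero a \/ is_iso m.

Definition is_coproduct (I : Type) (s : I -> C) x (inj : forall i, hom (s i) x) :
    Prop :=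
  forall t (f : forall i, hom (s i) t),
    exists! u : hom x t, forall i, u ∘ inj i = f i.

Definition is_semisimple_ob x : Prop :=
  exists (I : Type) (s : I -> C) (inj : forall i, hom (s i) x),
    (forall i, is_simple (s i)) /\ is_coproduct inj.

Definition is_semisimple : Prop := forall x, is_semisimple_ob x.

End Basic.

Definition opposite (C : category) : category :=
  @Category C (fun a b => hom b a) (fun a => idm a)
    (fun a b c g f => f ∘ g)
    (fun a b f => compm1 f) (fun a b f => comp1m f)
    (fun a b c d h g f => esym (compA f g h)).

(* A full and replete subcategory is determined by its class of objects. *)
Record subcategory (C : category) := Subcategory {
  in_subcat :> C -> Prop;
  subcat_replete : forall a b, isomorphic a b -> in_subcat a -> in_subcat b }.

Definition full_on (C : category) (P : C -> Prop) : category :=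
  @Category {a : C | P a} (fun a b => hom (sval a) (sval b))
    (fun a => idm (sval a)) (fun a b c g f => g ∘ f)
    (fun a b f => comp1m f) (fun a b f => compm1 f)
    (fun a b c d h g f => compA h g f).

Definition subcat_cat (C : category) (U : subcategory C) : category := full_on U.
Coercion subcat_cat : subcategory >-> category.

Record functor (C D : category) := Functor {
  fobj :> C -> D;
  fmap : forall a b, hom a b -> hom (fobj a) (fobj b);
  fmap1 : forall a, fmap (idm a) = idm (fobj a);
  fmapM : forall a b c (g : hom b c) (f : hom a b),
    fmap (g ∘ f) = fmap g ∘ fmap f }.

Arguments fmap {C D} f [a b] _ : rename.

Section FunctorCategory.
Variables C D : category.

Record natural (F G : functor C D) := Natural {
  component :> forall a, hom (F a) (G a);
  naturality : forall a b (f : hom a b),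
    component b ∘ fmap F f = fmap G f ∘ component a }.

Lemma natural_eq F G (s t : natural F G) : (forall a, s a = t a) -> s = t.
Proof.
case: s t => s sn [t tn] /= e.
have est : s = t by apply: functional_extensionality_dep.
by subst t; rewrite (Prop_irrelevance sn tn).
Qed.

Lemma natural_id_subproof (F : functor C D) a b (f : hom a b) :
  idm (F b) ∘ fmap F f = fmap F f ∘ idm (F a).
Proof. by rewrite comp1m compm1. Qed.

Definition natural_id F : natural F F := Natural (@natural_id_subproof F).

Lemma natural_comp_subproof F G H (t : natural G H) (s : natural F G)
    a b (f : hom a b) :
  (t b ∘ s b) ∘ fmap F f = fmap H f ∘ (t a ∘ s a).
Proof. by rewrite -compA naturality compA naturality compA. Qed.

Definition natural_comp F G H (t : natural G H) (s : natural F G) :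
  natural F H := Natural (natural_comp_subproof t s).

Definition functor_category : category.
Proof.
apply: (@Category (functor C D) natural natural_id natural_comp).
- by move=> F G s; apply: natural_eq => a; apply: comp1m.
- by move=> F G s; apply: natural_eq => a; apply: compm1.
- by move=> F G H K u t s; apply: natural_eq => a; apply: compA.
Defined.

End FunctorCategory.

Section Vect.
Variable k : fieldType.

Lemma linear_eq (V W : lmodType k) (f g : {linear V -> W}) : f =1 g -> f = g.
Proof.
case: f g => f [[fD] [fZ]] [g [[gD] [gZ]]] /= e.
have efg : f = g by apply: funext.
by subst g; rewrite (Prop_irrelevance fD gD) (Prop_irrelevance fZ gZ).
Qed.

(* Vector spaces of arbitrary dimension. *)
Definition Vect : category.
Proof.
apply: (@Category (lmodType k) (fun V W => {linear V -> W})
          (fun V => idfun) (fun U V W g f => g \o f)).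
- by move=> V W f; apply: linear_eq.
- by move=> V W f; apply: linear_eq.
- by move=> U V W X h g f; apply: linear_eq.
Defined.

End Vect.

Section FinGroups.
Local Open Scope group_scope.

Section Homs.
Variables G H : finGroupType.

Definition surj_homs : {set {ffun G -> H}} :=
  [set f : {ffun G -> H} | morphic [set: G] f & f @: [set: G] == [set: H]].

Definition conj_class (f : {ffun G -> H}) : {set {ffun G -> H}} :=
  [set [ffun x => f x ^ h] | h : H].

Definition is_hom_class (A : {set {ffun G -> H}}) : bool :=
  A \in [set conj_class f | f in surj_homs].

Definition out_hom : Type := {A : {set {ffun G -> H}} | is_hom_class A}.

End Homs.

Lemma surj_homsP (G H : finGroupType) (f : {ffun G -> H}) :
  reflect ({morph f : x y / x * y} /\ (forall y, exists x, f x = y))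
          (f \in surj_homs G H).
Proof.
rewrite inE; apply: (iffP andP) => [[/morphicP fM /eqP fT]|[fM fS]]; split.
- by move=> x y; rewrite fM ?inE.
- by move=> y; move: (in_setT y); rewrite -fT => /imsetP[x _ ->]; exists x.
- by apply/morphicP => x y _ _; apply: fM.
- apply/eqP/setP => y; rewrite inE; apply/imsetP.
  by have [x <-] := fS y; exists x.
Qed.

(* The elementwise composite of two conjugacy classes of homomorphisms is a
   single conjugacy class, that of the composite of any representatives. *)
Definition class_comp (G H K : finGroupType) (B : {set {ffun H -> K}})
    (A : {set {ffun G -> H}}) : {set {ffun G -> K}} :=
  [set [ffun x => g (f x)] | g : {ffun H -> K} in B, f : {ffun G -> H} in A].

Lemma class_compE (G H K : finGroupType) (g : {ffun H -> K})
    (f : {ffun G -> H}) :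
  {morph g : x y / x * y} ->
  class_comp (conj_class g) (conj_class f) = conj_class [ffun x => g (f x)].
Proof.
move=> gM.
have g1 : g 1 = 1 by apply: (mulgI (g 1)); rewrite -gM !mulg1.
have gV x : g x^-1 = (g x)^-1.
  by apply: (mulgI (g x)); rewrite -gM !mulgV g1.
apply/setP => u; apply/imset2P/imsetP => [[g' f']|[h _ ->]].
  move=> /imsetP[h _ ->] /imsetP[l _ ->] ->; exists (g l * h) => //.
  by apply/ffunP => x; rewrite !ffunE /= conjgM /conjg !gM gV.
exists [ffun x => g x ^ h] [ffun x => f x ^ 1]; try exact: imset_f.
by apply/ffunP => x; rewrite !ffunE conjg1.
Qed.

Lemma out_id_subproof (G : finGroupType) :
  is_hom_class (conj_class [ffun x : G => x]).
Proof.
apply/imset_f/surj_homsP; split=> [x y|y]; first by rewrite !ffunE.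
by exists y; rewrite ffunE.
Qed.

Definition out_id (G : finGroupType) : out_hom G G :=
  exist (@is_hom_class _ _) _ (out_id_subproof G).

Lemma out_comp_subproof (G H K : finGroupType) (B : out_hom H K)
    (A : out_hom G H) :
  is_hom_class (class_comp (sval B) (sval A)).
Proof.
have /imsetP[g /surj_homsP[gM gS] eB] := svalP B.
have /imsetP[f /surj_homsP[fM fS] eA] := svalP A.
rewrite eA eB class_compE //; apply/imset_f/surj_homsP; split=> [x y|z].
  by rewrite !ffunE fM gM.
by have [y <-] := gS z; have [x <-] := fS y; exists x; rewrite ffunE.
Qed.

Definition out_comp (G H K : finGroupType) (B : out_hom H K)
  (A : out_hom G H) : out_hom G K := exist (@is_hom_class _ _) _ (out_comp_subproof B A).

Lemma out_comp1m (G H : finGroupType) (A : out_hom G H) :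
  out_comp (out_id H) A = A.
Proof.
apply: val_inj; have /imsetP[f _ eA] := svalP A.
rewrite /= eA class_compE; first by congr conj_class; apply/ffunP=> x; rewrite !ffunE.
by move=> x y; rewrite !ffunE.
Qed.

Lemma out_compm1 (G H : finGroupType) (A : out_hom G H) :
  out_comp A (out_id G) = A.
Proof.
apply: val_inj; have /imsetP[f /surj_homsP[fM _] eA] := svalP A.
by rewrite /= eA class_compE //; congr conj_class; apply/ffunP=> x; rewrite !ffunE.
Qed.

Lemma out_compA (G H K L : finGroupType) (A3 : out_hom K L) (A2 : out_hom H K)
    (A1 : out_hom G H) :
  out_comp A3 (out_comp A2 A1) = out_comp (out_comp A3 A2) A1.
Proof.
apply: val_inj; have /imsetP[f _ e1] := svalP A1.
have /imsetP[g /surj_homsP[gM _] e2] := svalP A2.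
have /imsetP[h /surj_homsP[hM _] e3] := svalP A3.
rewrite /= e1 e2 e3 !class_compE //; last by move=> x y; rewrite !ffunE gM hM.
by congr conj_class; apply/ffunP=> x; rewrite !ffunE.
Qed.

(* The category of finite groups and conjugacy classes of surjective
   homomorphisms; an object is a whole [finGroupType], not a subgroup. *)
Definition FinGrp : category :=
  Category out_comp1m out_compm1 out_compA.

End FinGroups.

(* The category written A U in the literature. *)
Definition presheaves (k : fieldType) (U : category) : category :=
  functor_category (opposite U) (Vect k).

(* Main.v *)
Require Import Defs.
From Stdlib Require List.
From HB Require Import structures.
From mathcomp Require Import all_boot all_order all_algebra all_fingroup.
From mathcomp Require Import boolp.

Import Defs.

Set Implicit Arguments.
Unset Strict Implicit.
Unset Printing Implicit Defensive.

Import GRing.Theory.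
Local Open Scope ring_scope.
Local Open Scope cat_scope.

(** The theorem is proved in the cycle groupoid => split => semisimple =>
    groupoid.  The first two steps concern functors [C -> Vect k] on a category
    [C] satisfying suitable hypotheses, later taken to be the opposite of [U].

    Groupoid => split is Maschke's theorem.  An epimorphism [p : Y -> Z] is
    surjective at each object ([short_exact_surj]), hence has linear sections
    object by object ([surj_section]).  They need not be natural, but choosing a
    representative [r] of each isomorphism class and averaging the conjugates of
    the section at [r] over the finite set of isomorphisms [a -> r] gives a
    natural one ([groupoid_split]).  Characteristic zero is what allows the
    division by the number of these isomorphisms.

    Split => semisimple is the module-theoretic argument.  In a split category
    every subfunctor has a complement ([split_complement], via the quotient
    functor).  So, when [x] lies outside a subfunctor [N0], a subfunctor [N]
    containing [N0] and maximal among those avoiding [x] has a complement, and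
    the component of [x] in that complement generates a minimal subfunctor
    disjoint from [N0] ([split_minimal]).  A maximal independent set of minimal
    subfunctors therefore spans everything ([split_independent]), and an
    independent spanning set exhibits a functor as a coproduct
    ([independent_coproduct]).

    Semisimple => groupoid uses the order of a group as a degree, monotone along
    the morphisms of [C].  The elements of a simple functor in degrees above [n]
    form a subfunctor, which is zero or everything; so every morphism that
    strictly raises the degree acts by zero on simple functors, and then on all
    semisimple ones.  It acts by the identity on the constant functor [k]; hence
    there is no such morphism ([semisimple_deg]), all surjections in [U] are
    between groups of the same order, and they are isomorphisms
    ([eq_card_is_iso]). *)

(** * Zorn's lemma in a complete lattice *)

Section Zorn.
Variables (T : Type) (le : T -> T -> Prop) (sup : (T -> Prop) -> T).
Hypotheses (le_refl : forall x, le x x)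
  (le_trans : forall x y z, le x y -> le y z -> le x z)
  (le_anti : forall x y, le x y -> le y x -> x = y)
  (sup_ub : forall (A : T -> Prop) x, A x -> le x (sup A))
  (sup_le : forall (A : T -> Prop) y, (forall x, A x -> le x y) -> le (sup A) y).

(** The transfinite iterates of [f] from [x0], without ordinals: the values
    reached by applying [f] and taking suprema. *)
Inductive tower (f : T -> T) (x0 : T) : T -> Prop :=
| Tower0 : tower f x0 x0
| TowerS x : tower f x0 x -> tower f x0 (f x)
| TowerU A : (exists x, A x) -> (forall x, A x -> tower f x0 x) ->
    tower f x0 (sup A).

Section Tower.
Variables (f : T -> T) (x0 : T).
Hypothesis f_infl : forall x, le x (f x).
Notation tower := (tower f x0).

Lemma tower_ge x : tower x -> le x0 x.
Proof.
elim=> {x} [//|x _ x0x|A [x Ax] _ IH]; first exact: le_trans (f_infl x).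
exact: le_trans (IH x Ax) (sup_ub Ax).
Qed.

Let extreme c := forall x, tower x -> le x c -> x <> c -> le (f x) c.

Let extremeP c : tower c -> extreme c ->
  forall x, tower x -> le x c \/ le (f c) x.
Proof.
move=> tc ec x; elim=> {x} [|x tx [xc|cx]|A _ tA IH].
- by left; apply: tower_ge.
- have [->|xc'] := pselect (x = c); first by right.
  by left; apply: ec.
- by right; apply: le_trans (f_infl x).
- have [[x Ax cx]|nA] := pselect (exists2 x, A x & le (f c) x).
    by right; apply: le_trans (sup_ub Ax).
  left; apply: sup_le => y Ay; have [//|cy] := IH y Ay.
  by case: nA; exists y.
Qed.

Let tower_extreme c : tower c -> extreme c.
Proof.
elim=> {c} [|z tz ez|A A0 tA eA] x tx xc x_neq.
- by case: x_neq; apply: le_anti => //; apply: tower_ge.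
- have [xz|zx] := extremeP tz ez tx; last by case: x_neq; apply: le_anti.
  have [->//|xz'] := pselect (x = z).
  by apply: le_trans (f_infl z); apply: ez.
- have [[a Aa nax]|nA] := pselect (exists2 a, A a & ~ le (f a) x); last first.
    case: x_neq; apply: le_anti => //; apply: sup_le => a Aa.
    apply: le_trans (f_infl a) _; have [//|nax] := pselect (le (f a) x).
    by case: nA; exists a.
  have [xa|//] := extremeP (tA a Aa) (eA a Aa) tx.
  have [eax|xa'] := pselect (x = a); last first.
    by apply: le_trans (sup_ub Aa); apply: eA.
  have ex : extreme x by rewrite eax; apply: eA.
  have [Ax|//] := extremeP tx ex (TowerU A0 tA).
  by case: x_neq; apply: le_anti.
Qed.

(** The Bourbaki--Witt argument: an extreme element, one that [f] does not jump
    past from below, is comparable with the whole tower, and by induction along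
    the tower all its members are extreme. *)
Lemma tower_total x y : tower x -> tower y -> le x y \/ le y x.
Proof.
move=> tx ty; have [|yx] := extremeP ty (tower_extreme ty) tx; first by left.
by right; apply: le_trans (f_infl y) yx.
Qed.

End Tower.

(** Iterate a map that moves every element of [P] that is not maximal to a
    strictly larger one in [P].  The supremum of its tower is again in the tower,
    so it is a fixed point of the map, and therefore maximal.  Only the
    suprema of nonempty chains have to stay in [P]. *)
Lemma lattice_zorn (P : T -> Prop) x0 :
  (forall A : T -> Prop, (exists x, A x) -> (forall x, A x -> P x) ->
    (forall x y, A x -> A y -> le x y \/ le y x) -> P (sup A)) ->
  P x0 ->
  exists m, [/\ P m, le x0 m & forall y, P y -> le m y -> y = m].
Proof.
move=> Psup Px0.
(* The map fixes [x] in [P] only when [x] is maximal. *)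
have step x : exists y, [/\ le x y, P x -> P y &
    x = y -> P x -> forall z, P z -> le x z -> z = x].
  have [[y [Py xy xNy]]|nx] := pselect (exists y, [/\ P y, le x y & x <> y]).
    by exists y; split.
  exists x; split=> // _ _ z Pz xz; have [//|zx] := pselect (z = x).
  by case: nx; exists z; split=> // /esym.
pose f x := sval (cid (step x)).
have f_infl x : le x (f x) by rewrite /f; case: cid => y [].
have fP x : P x -> P (f x) by rewrite /f; case: cid => y [].
have tP x : tower f x0 x -> P x.
  elim=> {x} [//|x _ /fP //|A A0 tA PA]; apply: Psup => // x y Ax Ay.
  exact: (@tower_total f x0 f_infl) (tA _ Ax) (tA _ Ay).
pose m := sup (tower f x0).
have tm : tower f x0 m by apply: TowerU => //; exists x0; apply: Tower0.
have fm : m = f m by apply: le_anti => //; apply/sup_ub/TowerS.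
exists m; split; [exact: tP|exact: tower_ge tm|].
by move: fm (tP m tm); rewrite {1}/f; case: cid => y /= [_ _]; apply.
Qed.

End Zorn.

(** * Submodules as vector spaces *)

Section Submodules.
Variable k : fieldType.
Implicit Types V W : lmodType k.

Definition mklin V W (f : V -> W) (fl : linear f) : {linear V -> W} :=
  HB.pack f (GRing.isLinear.Build k V W _ f fl).

(** Membership is a proposition, since the submodules that occur (joins,
    images, kernels) are undecidable. *)
Record submod V := Submod {
  smem :> V -> Prop;
  smem0 : smem 0;
  smemL : forall c u v, smem u -> smem v -> smem (c *: u + v) }.

Definition smem_pred V (S : submod V) : {pred V} := fun x => `[< S x >].

Lemma smem_pred_closed V (S : submod V) : submod_closed (smem_pred S).
Proof.
split; first exact/asboolP/smem0.
by move=> c u v /asboolP Su /asboolP Sv; apply/asboolP/smemL.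
Qed.

HB.instance Definition _ V (S : submod V) :=
  GRing.isSubmodClosed.Build k V (smem_pred S) (smem_pred_closed S).

Record fiber V (S : submod V) :=
  Fiber { fval : V; fiber_pred : fval \in smem_pred S }.

HB.instance Definition _ V (S : submod V) := [isSub for @fval V S].
HB.instance Definition _ V (S : submod V) := [Choice of fiber S by <:].
HB.instance Definition _ V (S : submod V) :=
  [SubChoice_isSubLmodule of fiber S by <:].

Lemma smemD V (S : submod V) u v : S u -> S v -> S (u + v).
Proof. by move=> Su Sv; rewrite -[u]scale1r; apply: smemL. Qed.

Lemma smemZ V (S : submod V) c u : S u -> S (c *: u).
Proof. by move=> Su; rewrite -[_ *: _]addr0; apply: smemL => //; apply: smem0. Qed.

Lemma smemB V (S : submod V) u v : S u -> S v -> S (u - v).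
Proof. by move=> Su Sv; apply: smemD => //; rewrite -scaleN1r; apply: smemZ. Qed.

Definition fiber_of V (S : submod V) x (Sx : S x) : fiber S :=
  Fiber (introT (asboolP _) Sx : x \in smem_pred S).

Lemma fvalP V (S : submod V) (x : fiber S) : S (fval x).
Proof. exact/asboolP/(fiber_pred x). Qed.

Definition fincl V (S : submod V) : {linear fiber S -> V} :=
  mklin ((fun c x y => linearP (val : {linear fiber S -> V}) c x y)
    : linear (@fval V S)).

Definition fcorestr V W (S : submod V) (f : {linear W -> V})
    (Sf : forall x, S (f x)) : {linear W -> fiber S}.
Proof.
apply: (@mklin _ _ (fun x => fiber_of (Sf x))) => c x y.
by apply: val_inj; rewrite /= linearP.
Defined.

End Submodules.

(** * Functors to vector spaces and their subfunctors *)

Section Presheaves.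
Variables (k : fieldType) (C : category).
Notation presheaf := (functor C (Vect k)).
Notation psh := (functor_category C (Vect k)).

(** The data of functors and transformations, restated at the types of linear
    algebra so that its lemmas apply to them. *)
Definition space (F : presheaf) (a : C) : lmodType k := F a.
Definition act (F : presheaf) (a b : C) (f : hom a b) :
  {linear space F a -> space F b} := fmap F f.
Definition at_ob (F G : presheaf) (t : natural F G) (a : C) :
  {linear space F a -> space G a} := t a.

Lemma act1 F a x : act F (idm a) x = x.
Proof. by rewrite /act fmap1. Qed.

Lemma actM F (a b c : C) (g : hom b c) (f : hom a b) x :
  act F (g ∘ f) x = act F g (act F f x).
Proof. by rewrite /act fmapM. Qed.

Lemma at_ob_nat F G (t : natural F G) (a b : C) (f : hom a b) x :
  at_ob t b (act F f x) = act G f (at_ob t a x).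
Proof. exact: (congr1 (fun h : {linear _ -> _} => h x) (naturality t f)). Qed.

Lemma nat_ext F G (s t : natural F G) :
  (forall a x, at_ob s a x = at_ob t a x) -> s = t.
Proof. by move=> e; apply: natural_eq => a; apply: linear_eq => x; apply: e. Qed.

Definition mkpresheaf (V : C -> lmodType k)
    (A : forall a b, hom a b -> {linear V a -> V b})
    (A1 : forall a x, A a a (idm a) x = x)
    (AM : forall a b c (g : hom b c) (f : hom a b) x,
      A a c (g ∘ f) x = A b c g (A a b f x)) : presheaf.
Proof.
refine (@Functor C (Vect k) V A _ _).
- by move=> a; apply: linear_eq => x; apply: A1.
- by move=> a b c g f; apply: linear_eq => x; apply: AM.
Defined.

Definition mknat F G (t : forall a, {linear space F a -> space G a})
    (tn : forall a b (f : hom a b) x, t b (act F f x) = act G f (t a x)) :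
  natural F G.
Proof.
refine (@Natural C (Vect k) F G t _).
by move=> a b f; apply: linear_eq => x; apply: tn.
Defined.

Lemma at_ob_comp (F G H : psh) (t : hom G H) (s : hom F G) a x :
  at_ob (t ∘ s) a x = at_ob t a (at_ob s a x).
Proof. by []. Qed.

Lemma at_ob_id (F : psh) a x : at_ob (idm F) a x = x.
Proof. by []. Qed.

Record subfunctor (F : presheaf) := Subfunctor {
  stalk :> forall a, submod (space F a);
  stalk_act : forall a b (f : hom a b) x, stalk a x -> stalk b (act F f x) }.

Section Sub.
Variable F : presheaf.
Implicit Types S T N : subfunctor F.

Definition sub S : presheaf.
Proof.
apply: (@mkpresheaf (fun a => fiber (S a)) (fun a b f =>
  @fcorestr k _ _ _ (act F f \o fincl (S a)) (fun x => stalk_act f (fvalP x)))).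
- by move=> a x; apply: val_inj; rewrite /= act1.
- by move=> a b c g f x; apply: val_inj; rewrite /= actM.
Defined.

Definition incl S : natural (sub S) F.
Proof. by apply: (@mknat (sub S) F (fun a => fincl (S a))). Defined.

Lemma incl_inj S a (x y : space (sub S) a) :
  at_ob (incl S) a x = at_ob (incl S) a y -> x = y.
Proof. exact: val_inj. Qed.

Lemma inclP S a (x : space (sub S) a) : S a (at_ob (incl S) a x).
Proof. exact: fvalP. Qed.

Definition corestr S G (t : natural G F) (St : forall a x, S a (at_ob t a x)) :
  natural G (sub S).
Proof.
apply: (@mknat G (sub S) (fun a => fcorestr (St a))).
by move=> a b f x; apply: val_inj => /=; rewrite at_ob_nat.
Defined.

Lemma incl_corestr S G (t : natural G F) (St : forall a x, S a (at_ob t a x)) a x :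
  at_ob (incl S) a (at_ob (corestr St) a x) = at_ob t a x.
Proof. by []. Qed.

Lemma incl_lift S a x :
  S a x -> exists y : space (sub S) a, at_ob (incl S) a y = x.
Proof. by move=> Sx; exists (fiber_of Sx). Qed.

(** Subfunctors of [F] form a complete lattice, with joins obtained as meets of
    upper bounds: no finite sums need to be handled to define them. *)
Definition sub_le S T := forall a x, S a x -> T a x.

Lemma sub_le_anti S T : sub_le S T -> sub_le T S -> S = T.
Proof.
case: S T => S Sact [T Tact] ST TS.
have {}ST a x : S a x -> T a x by apply: ST.
have {}TS a x : T a x -> S a x by apply: TS.
have e a : S a = T a.
  case: (S a) (T a) (ST a) (TS a) => P P0 PL [Q Q0 QL] /= PQ QP.
  have e : P = Q by apply: funext => x; apply/propext; split; [apply: PQ|apply: QP].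
  by subst Q; rewrite (Prop_irrelevance P0 Q0) (Prop_irrelevance PL QL).
have {}e : S = T by apply: functional_extensionality_dep.
by subst T; rewrite (Prop_irrelevance Sact Tact).
Qed.

Definition mksub (P : forall a, space F a -> Prop) (P0 : forall a, P a 0)
    (PL : forall a c u v, P a u -> P a v -> P a (c *: u + v))
    (Pact : forall a b (f : hom a b) x, P a x -> P b (act F f x)) :
  subfunctor F := @Subfunctor F (fun a => Submod (P0 a) (PL a)) Pact.

Definition sub0 : subfunctor F.
Proof.
refine (@mksub (fun a x => x = 0) _ _ _) => //.
- by move=> a c u v -> ->; rewrite scaler0 addr0.
- by move=> a b f x ->; rewrite linear0.
Defined.

Definition sub_meet (P : subfunctor F -> Prop) : subfunctor F.
Proof.
refine (@mksub (fun a x => forall S, P S -> S a x) _ _ _).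
- by move=> a S _; apply: smem0.
- by move=> a c u v Pu Pv S PS; apply: smemL; [apply: Pu|apply: Pv].
- by move=> a b f x Px S PS; apply/stalk_act/Px.
Defined.

Definition sub_join (P : subfunctor F -> Prop) : subfunctor F :=
  sub_meet (fun T => forall S, P S -> sub_le S T).

Definition sub_gen a (x : space F a) : subfunctor F :=
  sub_meet (fun T => T a x).

Definition sub_add S T : subfunctor F.
Proof.
refine (@mksub (fun a x => exists s t, [/\ S a s, T a t & x = s + t]) _ _ _).
- by move=> a; exists 0, 0; rewrite addr0; split=> //; apply: smem0.
- move=> a c _ _ [s [t [Ss Tt ->]]] [s' [t' [Ss' Tt' ->]]].
  exists (c *: s + s'), (c *: t + t'); split; try exact: smemL.
  by rewrite scalerDr addrACA.
- move=> a b f _ [s [t [Ss Tt ->]]]; exists (act F f s), (act F f t).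
  by rewrite linearD; split=> //; apply: stalk_act.
Defined.

Definition sub_chain_union (A : subfunctor F -> Prop)
    (A0 : exists S, A S)
    (Atot : forall S T, A S -> A T -> sub_le S T \/ sub_le T S) : subfunctor F.
Proof.
refine (@mksub (fun a x => exists2 S, A S & S a x) _ _ _).
- by move=> a; case: A0 => S AS; exists S => //; apply: smem0.
- move=> a c u v [S AS Su] [T AT Tv].
  by have [ST|TS] := Atot _ _ AS AT; [exists T|exists S] => //; apply: smemL => //;
    [apply: ST|apply: TS].
- by move=> a b f x [S AS Sx]; exists S => //; apply: stalk_act.
Defined.

Definition equalizer G (u v : natural F G) : subfunctor F.
Proof.
refine (@mksub (fun a x => at_ob u a x = at_ob v a x) _ _ _).
- by move=> a; rewrite !linear0.
- by move=> a c x y ex ey; rewrite !linearP ex ey.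
- by move=> a b f x e; rewrite !at_ob_nat e.
Defined.

Definition nat_image G (t : natural G F) : subfunctor F.
Proof.
refine (@mksub (fun a x => exists y, at_ob t a y = x) _ _ _).
- by move=> a; exists 0; rewrite linear0.
- by move=> a c _ _ [x <-] [y <-]; exists (c *: x + y); rewrite linearP.
- by move=> a b f _ [x <-]; exists (act G f x); rewrite at_ob_nat.
Defined.

Lemma sub_join_ub (P : subfunctor F -> Prop) S : P S -> sub_le S (sub_join P).
Proof. by move=> PS a x Sx T PT; apply: PT PS _ _ Sx. Qed.

Lemma sub_join_le (P : subfunctor F -> Prop) T :
  (forall S, P S -> sub_le S T) -> sub_le (sub_join P) T.
Proof. by move=> PT a x; apply. Qed.

Lemma sub_gen_self a (x : space F a) : sub_gen x a x.
Proof. by move=> T. Qed.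

Lemma sub_gen_le a (x : space F a) T : T a x -> sub_le (sub_gen x) T.
Proof. by move=> Tx b y; apply. Qed.

Lemma sub_addl S T : sub_le S (sub_add S T).
Proof. by move=> a x Sx; exists x, 0; rewrite addr0; split=> //; apply: smem0. Qed.

Lemma sub_addr S T : sub_le T (sub_add S T).
Proof. by move=> a x Sx; exists 0, x; rewrite add0r; split=> //; apply: smem0. Qed.

Definition disjoint S T := forall a x, S a x -> T a x -> x = 0.

(** The join of a nonempty chain is its union. *)
Lemma sub_chain_join (A : subfunctor F -> Prop) a x :
  (exists S, A S) ->
  (forall S T, A S -> A T -> sub_le S T \/ sub_le T S) ->
  sub_join A a x -> exists2 S, A S & S a x.
Proof.
move=> A0 Atot Ax; apply: (Ax (sub_chain_union A0 Atot)) => S AS b y Sy.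
by exists S.
Qed.

Lemma sub_maximal (P : subfunctor F -> Prop) S0 :
  (forall A, (exists S, A S) -> (forall S, A S -> P S) ->
    (forall S T, A S -> A T -> sub_le S T \/ sub_le T S) -> P (sub_join A)) ->
  P S0 ->
  exists N, [/\ P N, sub_le S0 N & forall T, P T -> sub_le N T -> T = N].
Proof.
apply: (@lattice_zorn _ sub_le sub_join) => //.
- by move=> S a x.
- by move=> S T N ST TN a x /ST; exact: TN.
- exact: sub_le_anti.
- exact: sub_join_ub.
- by move=> A S AS; apply: sub_join_le.
Qed.

Definition complement S T := disjoint S T /\ (forall a x, sub_add S T a x).

Lemma complement_uniq S T a (x s s' : space F a) : disjoint S T ->
  S a s -> S a s' -> T a (x - s) -> T a (x - s') -> s = s'.
Proof.
move=> ST Ss Ss' Tx Tx'; apply/eqP; rewrite -subr_eq0; apply/eqP.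
apply: ST; first exact: smemB.
have -> : s - s' = (x - s') - (x - s) by rewrite [in RHS]opprB [RHS]addrC addrA subrK.
exact: smemB.
Qed.

(** Each [x] is uniquely [s + t] with [s] in [S] and [t] in [T]; the projection
    is [x |-> s], and uniqueness makes it linear and natural. *)
Lemma complement_proj S T : complement S T ->
  exists p : natural F (sub S),
    (forall a x, at_ob p a (at_ob (incl S) a x) = x) /\
    (forall a x, at_ob p a x = 0 <-> T a x).
Proof.
move=> [ST FST].
have dec a x : exists s, S a s /\ T a (x - s).
  by have [s [t [Ss Tt ->]]] := FST a x; exists s; rewrite addrC addKr.
pose s a x := sval (cid (dec a x)).
have sS a x : S a (s a x) by rewrite /s; case: cid => y [].
have sT a x : T a (x - s a x) by rewrite /s; case: cid => y [].
have sL a : linear (s a).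
  move=> c x y; apply: (complement_uniq (x := c *: x + y) ST) => //.
  - exact: smemL.
  - have -> : c *: x + y - (c *: s a x + s a y) = c *: (x - s a x) + (y - s a y).
      by rewrite opprD addrACA scalerBr.
    exact: smemL.
have sN a b (f : hom a b) x : s b (act F f x) = act F f (s a x).
  apply: (complement_uniq (x := act F f x) ST) => //; first exact: stalk_act.
  by rewrite -linearB; apply: stalk_act.
pose e : natural F F := @mknat F F (fun a => mklin (sL a)) sN.
exists (corestr (t := e) sS); split=> [a x|a x].
  apply: incl_inj; rewrite incl_corestr /at_ob /=.
  apply: (complement_uniq (x := fval x) ST) => //; first exact: inclP.
  by rewrite subrr; apply: smem0.
split=> [px0|Tx].
  have sx0 : s a x = 0 by have := congr1 (at_ob (incl S) a) px0; rewrite linear0.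
  by rewrite -[x]subr0 -sx0.
apply: incl_inj; rewrite incl_corestr linear0 /at_ob /=.
apply: (complement_uniq (x := x) ST) => //; first exact: smem0.
by rewrite subr0.
Qed.

End Sub.

Definition zero_nat (F G : psh) : hom F G :=
  @mknat F G (fun a => \0%R) (fun a b f x => esym (linear0 (act G f))).

(** On a zero object the identity and the zero transformation coincide. *)
Lemma is_zeroP (F : psh) : is_zero F <-> forall a (x : space F a), x = 0.
Proof.
split=> [[_ F1] a x|F0].
  have [i [_ iE]] := F1 F.
  by rewrite -[LHS](at_ob_id x) -(iE (idm F)) // (iE (zero_nat F F)).
split=> G.
  exists (zero_nat F G); split=> // t _; apply: nat_ext => a x.
  by rewrite (F0 a x) !linear0.
exists (zero_nat G F); split=> // t _; apply: nat_ext => a x.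
by rewrite (F0 a (at_ob t a x)).
Qed.

Lemma is_zero_morP (F G : psh) (t : hom F G) :
  is_zero_mor t <-> forall a x, at_ob t a x = 0.
Proof.
split=> [[Z [/is_zeroP Z0 [p [i ->]]]] a x|t0].
  by rewrite at_ob_comp (Z0 a (at_ob p a x)) linear0.
exists (sub (sub0 F)); split.
  by apply/is_zeroP => a x; apply: incl_inj; rewrite linear0; apply: (inclP x).
exists (zero_nat _ _), (zero_nat _ _).
by apply: nat_ext => a x; rewrite t0.
Qed.

(** The inclusion of the kernel of [m] and the zero map have the same composite
    with [m]. *)
Lemma mono_ker0 (F G : psh) (m : hom F G) a (x : space F a) :
  is_mono m -> at_ob m a x = 0 -> x = 0.
Proof.
move=> mm mx; pose K := equalizer m (zero_nat F G).
have [y <-] := @incl_lift F K a x mx.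
pose i : hom (sub K : psh) F := incl K.
have -> : incl K = zero_nat F F ∘ i.
  apply: (mm (sub K)); apply: nat_ext => b w; rewrite !at_ob_comp.
  by rewrite (inclP w) [in RHS]linear0.
by [].
Qed.

(** The corestriction of [p] to its image kills [i], so it factors through the
    cokernel [p]; this yields a section of the inclusion of the image, which is
    thus everything. *)
Lemma short_exact_surj (X Y Z : psh) (i : hom X Y) (p : hom Y Z) :
  short_exact i p -> forall a z, exists y, at_ob p a y = z.
Proof.
move=> [_ [/is_zero_morP ip pU]] a z.
pose q : hom Y (sub (nat_image p) : psh) :=
  corestr (t := p) (fun a y => ex_intro _ y erefl : nat_image p a (at_ob p a y)).
have [|u [uq _]] := pU (sub (nat_image p) : psh) q.
  by apply/is_zero_morP => b x; apply: incl_inj; rewrite linear0; apply: ip.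
pose j : hom (sub (nat_image p) : psh) Z := incl (nat_image p).
have [|w [_ wE]] := pU Z p; first exact/is_zero_morP.
have ju : j ∘ u = idm Z.
  apply: etrans (esym (wE _ _)) (wE _ _); last by rewrite comp1m.
  by rewrite -compA uq; apply: nat_ext.
by have := inclP (at_ob u a z); rewrite -[at_ob (incl _) _ _]/(at_ob (j ∘ u) a z) ju.
Qed.
End Presheaves.

(** * Splitting of vector spaces *)

Section LinearAlgebra.
Variable k : fieldType.

(** A vector space is a functor on the category with a single morphism, so
    that [sub_maximal] and [complement_proj] apply to its submodules. *)
Definition point : category.
Proof.
by refine (@Category unit (fun _ _ => unit) (fun _ => tt) (fun _ _ _ _ _ => tt)
  _ _ _) => //; move=> a b [].
Defined.

Definition on_point (V : lmodType k) : functor point (Vect k) :=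
  @mkpresheaf k point (fun _ => V) (fun _ _ _ => idfun)
    (fun _ _ => erefl) (fun _ _ _ _ _ _ => erefl).

Definition submod_on_point (V : lmodType k) (S : submod V) :
  subfunctor (on_point V).
Proof.
refine (@mksub k point (on_point V) (fun _ x => S x) _ _ _) => //.
- by move=> a; apply: smem0.
- by move=> a; apply: smemL.
Defined.

Definition line (V : lmodType k) (v : V) : submod V.
Proof.
refine (@Submod k V (fun x => exists c, x = c *: v) _ _).
- by exists 0; rewrite scale0r.
- by move=> c _ _ [a ->] [b ->]; exists (c * a + b); rewrite scalerDl scalerA.
Defined.

(** [W] is a complement of [S], namely a submodule maximal among those disjoint
    from [S], and [p] is the projection along [S]: it serves both as a quotient of
    [V] by [S] and as a splitting of that quotient. *)
Lemma submod_split (V : lmodType k) (S : submod V) :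
  exists (W : lmodType k) (p : {linear V -> W}) (s : {linear W -> V}),
    (forall w, p (s w) = w) /\ (forall v, p v = 0 <-> S v).
Proof.
pose S' := submod_on_point S.
have [| |M [MS _ Mmax]] := @sub_maximal k point (on_point V)
    (fun M => disjoint M S') (sub0 _).
- move=> A A0 AS Atot a x /(sub_chain_join A0 Atot)[T AT Tx]; exact: AS AT _ _ Tx.
- by move=> a x ->.
have cMS : complement M S'.
  split=> // -[] x; have [//|nx] := pselect (sub_add M S' tt x).
  (* Were [x] outside [M + S], adjoining the line of [x] to [M] would keep it
     disjoint from [S]. *)
  have Mx : disjoint (sub_add M (submod_on_point (line x))) S'.
    move=> [] _ [m [_ [Mm [c ->] ->]]] Sx.
    have [c0|c0] := eqVneq c 0.
      by move: Sx; rewrite c0 scale0r addr0; apply: MS.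
    case: nx; exists (- c^-1 *: m), (c^-1 *: (m + c *: x)); split.
    - exact: smemZ.
    - exact: smemZ.
    - by rewrite scalerDr scalerA mulVf // scale1r addrA -scalerDl addNr scale0r add0r.
  have eM := Mmax _ Mx (@sub_addl _ _ _ _ _).
  case: nx; apply: sub_addl; rewrite -eM; apply: sub_addr; exists 1.
  by rewrite scale1r.
have [p [pK pS]] := complement_proj cMS.
exists (space (sub M) tt), (at_ob p tt), (at_ob (incl M) tt); split=> [w|v].
  exact: pK.
exact: pS.
Qed.

(** With [s] and [p] splitting the quotient by [ker q], the map [s \o p]
    replaces a preimage of [z] by one that depends linearly on [z]. *)
Lemma surj_section (V Z : lmodType k) (q : {linear V -> Z}) :
  (forall z, exists v, q v = z) ->
  exists s : {linear Z -> V}, forall z, q (s z) = z.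
Proof.
move=> qS.
have K0 : q 0 = 0 by rewrite linear0.
have KL c u v : q u = 0 -> q v = 0 -> q (c *: u + v) = 0.
  by move=> qu qv; rewrite linearP qu qv scaler0 addr0.
have [W [p [s [sK pK]]]] := submod_split (Submod K0 KL).
pose pre z := sval (cid (qS z)).
have preE z : q (pre z) = z by rewrite /pre; case: cid.
have pL : linear (fun z => s (p (pre z))).
  move=> c x y; rewrite -linearP -linearP; congr (s _); apply/eqP.
  rewrite -subr_eq0 -linearB; apply/eqP/pK => /=.
  by rewrite linearB linearP !preE subrr.
exists (mklin pL) => z /=.
apply/eqP; rewrite -[X in _ == X]preE -subr_eq0 -linearB; apply/eqP.
by apply/(pK _); rewrite linearB sK subrr.
Qed.

End LinearAlgebra.

(** * Split implies semisimple *)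

Section Split.
Variables (k : fieldType) (C : category).
Notation presheaf := (functor C (Vect k)).
Notation psh := (functor_category C (Vect k)).
Implicit Types F G : presheaf.

(** [Q f] is [p \o F f \o s], for quotient maps [p] and linear sections [s]
    chosen at each object; it is functorial because [s (p x) - x] lies in the
    subfunctor [S], which [p] kills. *)
Lemma quotient_exists F (S : subfunctor F) :
  exists (Q : presheaf) (p : natural F Q),
    (forall a y, exists x, at_ob p a x = y) /\
    (forall a x, at_ob p a x = 0 <-> S a x).
Proof.
pose W a : lmodType k := sval (cid (submod_split (S a))).
have [p [s [sK pS]]] : exists (p : forall a, {linear space F a -> W a})
    (s : forall a, {linear W a -> space F a}),
    (forall a w, p a (s a w) = w) /\ (forall a v, p a v = 0 <-> S a v).
  have H a : exists ps : {linear space F a -> W a} * {linear W a -> space F a},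
      (forall w, ps.1 (ps.2 w) = w) /\ (forall v, ps.1 v = 0 <-> S a v).
    by rewrite /W; case: cid => V /= [p [s H]]; exists (p, s).
  exists (fun a => (sval (cid (H a))).1), (fun a => (sval (cid (H a))).2).
  by split=> a; case: cid => /= ps [].
have pact a b (f : hom a b) x : p b (act F f (s a (p a x))) = p b (act F f x).
  apply/eqP; rewrite -subr_eq0 -!linearB; apply/eqP/pS/stalk_act/pS.
  by rewrite linearB sK subrr.
pose Q : presheaf := @mkpresheaf k C W
  (fun a b f => (p b \o act F f \o s a : {linear W a -> W b}))
  (fun a x => etrans (congr1 (p a) (act1 (s a x))) (sK a x))
  (fun a b c g f x =>
    etrans (congr1 (p c) (actM g f (s a x))) (esym (pact _ _ _ _))).
exists Q, (@mknat k C F Q p (fun a b f x => esym (pact a b f x))).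
by split=> // a y; exists (s a y); apply: sK.
Qed.

Lemma quotient_short_exact F (S : subfunctor F) (Q : presheaf) (p : natural F Q) :
  (forall a y, exists x, at_ob p a x = y) -> (forall a x, at_ob p a x = 0 <-> S a x) ->
  @short_exact psh (sub S) F Q (incl S) p.
Proof.
move=> pS pK; split; split.
- by apply/is_zero_morP => a x; apply/pK/inclP.
- move=> T f /is_zero_morP pf.
  have Sf a x : S a (at_ob f a x) by apply/pK; apply: pf.
  exists (corestr Sf); split=> [|u uE]; first exact: nat_ext.
  by apply: nat_ext => a x; apply: incl_inj; rewrite incl_corestr -uE.
- by apply/is_zero_morP => a x; apply/pK/inclP.
- move=> T f /is_zero_morP fS.
  have fE a x y : at_ob p a x = at_ob p a y -> at_ob f a x = at_ob f a y.
    move=> e; apply/eqP; rewrite -subr_eq0 -linearB; apply/eqP.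
    have /pK Sxy : at_ob p a (x - y) = 0 by rewrite linearB e subrr.
    by have [w <-] := incl_lift Sxy; apply: fS.
  pose s a y := sval (cid (pS a y)).
  have sK a y : at_ob p a (s a y) = y by rewrite /s; case: cid.
  have uL a : linear (fun y => at_ob f a (s a y)).
    by move=> c x y; rewrite -linearP; apply: fE; rewrite linearP !sK.
  have uN a b (h : hom a b) y :
      mklin (uL b) (act Q h y) = act T h (mklin (uL a) y).
    by rewrite /= -at_ob_nat; apply: fE; rewrite at_ob_nat !sK.
  exists (mknat uN); split=> [|u uE].
    by apply: nat_ext => a x; apply: fE; rewrite sK.
  by apply: nat_ext => a y; rewrite -[y in RHS]sK -[RHS]at_ob_comp uE.
Qed.

(** The image of a section of [F -> F / S] is a complement of [S]. *)
Lemma split_complement F (S : subfunctor F) :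
  is_split psh -> exists T, complement S T.
Proof.
move=> sp; have [Q [p [pS pK]]] := quotient_exists S.
have [s ps] := sp _ _ _ _ _ (quotient_short_exact pS pK).
have psK a y : at_ob p a (at_ob s a y) = y by rewrite -[LHS]at_ob_comp ps.
exists (nat_image s); split=> [a x /pK px [y yx]|a x].
  by rewrite -yx -[y]psK yx px linear0.
exists (x - at_ob s a (at_ob p a x)), (at_ob s a (at_ob p a x)).
split; last by rewrite subrK.
  by apply/pK; rewrite linearB psK subrr.
by exists (at_ob p a x).
Qed.

Definition minimal F (S : subfunctor F) :=
  (exists a (x : space F a), S a x /\ x <> 0) /\
  forall T, sub_le T S -> (forall a x, T a x -> x = 0) \/ T = S.

Lemma bijective_iso (F G : psh) (m : hom F G) :
  (forall a x, at_ob m a x = 0 -> x = 0) ->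
  (forall a y, exists x, at_ob m a x = y) -> is_iso m.
Proof.
move=> m0 mS; pose s a y := sval (cid (mS a y)).
have sK a y : at_ob m a (s a y) = y by rewrite /s; case: cid.
have mI a x y : at_ob m a x = at_ob m a y -> x = y.
  move=> e; apply/eqP; rewrite -subr_eq0; apply/eqP/m0.
  by rewrite linearB e subrr.
have sL a : linear (s a) by move=> c x y; apply: mI; rewrite linearP !sK.
have sN a b (h : hom a b) y : mklin (sL b) (act G h y) = act F h (mklin (sL a) y).
  by apply: mI; rewrite at_ob_nat !sK.
exists (mknat sN); split; apply: nat_ext => a x; last exact: sK.
by apply: mI; rewrite sK.
Qed.

Lemma minimal_simple F (S : subfunctor F) :
  minimal S -> is_simple (sub S : psh).
Proof.
move=> [[a0 [x0 [Sx0 x0n]]] Smin]; split=> [/is_zeroP S0|G m mm].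
  by apply: x0n; have [y <-] := incl_lift Sx0; rewrite (S0 a0 y) linear0.
pose t : natural G F := @comp psh _ _ _ (incl S) m.
have [|t0|tS] := Smin (nat_image t).
- by move=> a _ [y <-]; apply: inclP.
- left; apply/is_zeroP => a x; apply: (mono_ker0 mm); apply: incl_inj.
  by rewrite linear0; apply: t0; exists x.
- right; apply: bijective_iso => [a x|a y]; first exact: mono_ker0.
  have := inclP y; rewrite -{1}tS => -[x xy]; exists x.
  exact: incl_inj.
Qed.

(** Let [N] contain [N0] and be maximal among the subfunctors avoiding [x], with
    complement [T], and let [x = n + t].  For a nonzero [T'] inside [T], maximality
    puts [x] in [N + T'], so [t] is in [T'] by uniqueness of components: [t]
    generates a minimal subfunctor. *)
Lemma split_minimal F (N0 : subfunctor F) a (x : space F a) :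
  is_split psh -> ~ N0 a x -> exists S, minimal S /\ disjoint S N0.
Proof.
move=> sp N0x.
have [|//|N [Nx N0N Nmax]] := @sub_maximal k C F (fun N => ~ N a x) N0.
  move=> A A0 AN Atot /(sub_chain_join A0 Atot)[T AT]; exact: AN.
have [T [NT FNT]] := split_complement N sp.
have [n [t [Nn Tt xE]]] := FNT a x.
have tT := sub_gen_le Tt.
exists (sub_gen t); split; last by move=> b y /tT Ty /N0N Ny; apply: NT Ny Ty.
split.
  exists a, t; split; first exact: sub_gen_self.
  by move=> t0; apply: Nx; rewrite xE t0 addr0.
move=> T' T't; have [T'0|nT'] := pselect (forall b y, T' b y -> y = 0); first by left.
right; apply: sub_le_anti => //; apply: sub_gen_le.
have [[n' [t' [Nn' T't' xE']]]|NT'x] := pselect (sub_add N T' a x).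
  have -> : t = t' => //; apply: (complement_uniq (x := x) (T := N) (S := T)) => //.
  - by move=> b y Ty Ny; apply: NT Ny Ty.
  - exact/tT/T't.
  - by rewrite xE addrK.
  - by rewrite xE' addrK.
have eN := Nmax _ NT'x (@sub_addl _ _ _ _ _).
case: nT' => b y T'y; apply: (NT b y); last exact/tT/T't.
by rewrite -eN; apply: sub_addr.
Qed.

Definition independent F (A : subfunctor F -> Prop) :=
  forall S, A S -> disjoint S (sub_join (fun T => A T /\ T <> S)).

Lemma sub_join_mono F (A B : subfunctor F -> Prop) :
  (forall S, A S -> B S) -> sub_le (sub_join A) (sub_join B).
Proof. by move=> AB; apply: sub_join_le => S /AB; apply: sub_join_ub. Qed.

(** A relation between [S] and the other members of the union of a chain of sets
    already holds in one set of the chain, since the joins of these sets without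
    [S] form a chain too. *)
Lemma independent_chain F (X : (subfunctor F -> Prop) -> Prop) :
  (forall A, X A -> independent A) ->
  (forall A B, X A -> X B ->
    (forall S, A S -> B S) \/ (forall S, B S -> A S)) ->
  independent (fun S => exists2 A, X A & A S).
Proof.
move=> XI Xtot S [A XA AS] a x Sx Jx.
pose D (N : subfunctor F) :=
  exists2 B, X B & N = sub_join (fun T => B T /\ T <> S).
have D0 : exists N, D N by exists (sub_join (fun T => A T /\ T <> S)), A.
have Dtot N N' : D N -> D N' -> sub_le N N' \/ sub_le N' N.
  move=> [B XB ->] [B' XB' ->].
  by have [BB'|BB'] := Xtot _ _ XB XB'; [left|right];
    apply: sub_join_mono => T [BT ?]; split=> //; apply: BB'.
have : sub_join D a x.
  move: (a) (x) Jx; apply: sub_join_le => T [[B XB BT] TS] b y Ty.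
  apply: (@sub_join_ub _ _ _ D (sub_join (fun T => B T /\ T <> S))); first by exists B.
  by apply: (@sub_join_ub _ _ _ (fun T => B T /\ T <> S) T).
move=> /(sub_chain_join D0 Dtot)[_ [B XB ->] Bx].
have [AB|BA] := Xtot _ _ XA XB; first by apply: XI XB _ (AB _ AS) _ _ Sx Bx.
apply: XI XA _ AS _ _ Sx _; apply: sub_join_mono Bx => T [/BA AT TS].
by split.
Qed.

Lemma independent_add F (A : subfunctor F -> Prop) S :
  independent A -> disjoint S (sub_join A) -> independent (fun T => A T \/ T = S).
Proof.
move=> AI SA B [AB|->] a x Bx Jx; last first.
  apply: SA Bx _; apply: sub_join_mono Jx => T [[//|->]]; by case.
have : sub_add (sub_join (fun T => A T /\ T <> B)) S a x.
  move: (a) (x) Jx; apply: sub_join_le => T [[AT|->] TB] b y Ty.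
    by apply/sub_addl/(@sub_join_ub _ _ _ (fun T => A T /\ T <> B) T).
  exact: sub_addr.
move=> [y [s [Jy Ss xE]]]; have s0 : s = 0.
  apply: (SA _ _ Ss); have -> : s = x - y by rewrite xE addrC addKr.
  apply: smemB; first exact: (@sub_join_ub _ _ _ _ B).
  by apply: sub_join_mono Jy => T [].
by apply: AI AB _ _ Bx _; rewrite xE s0 addr0.
Qed.

(** Take a maximal independent set of minimal subfunctors.  If its join missed
    some [x], [split_minimal] would give one more subfunctor to add. *)
Lemma split_independent F : is_split psh ->
  exists A : subfunctor F -> Prop,
    [/\ forall S, A S -> minimal S, independent A & forall a x, sub_join A a x].
Proof.
move=> sp; pose P A := (forall S : subfunctor F, A S -> minimal S) /\ independent A.
case: (@lattice_zorn (subfunctor F -> Prop) (fun A B => forall S, A S -> B S)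
    (fun X S => exists2 A, X A & A S) _ _ _ _ _ P (fun _ => False)).
- by [].
- by move=> A B D AB BD S /AB; exact: BD.
- by move=> A B AB BA; apply: funext => S; apply/propext; split; [apply: AB|apply: BA].
- by move=> X A XA S AS; exists A.
- by move=> X A XA S [B XB]; apply: XA.
- move=> X _ XP Xtot; split; first by move=> S [A /XP[Am _] /Am].
  by apply: independent_chain => // A /XP[].
- by split=> // S [].
move=> A [[Am AI] _ Amax]; exists A; split=> // a x.
have [//|nx] := pselect (sub_join A a x).
have [S [Sm SA]] := split_minimal sp nx.
have AS : A S.
  rewrite -(Amax (fun T => A T \/ T = S)); [by right| |by left].
  by split; [move=> T [/Am|->] //|apply: independent_add].
have [[b [y [Sy y0]]] _] := Sm.
by case: y0; apply: (SA b y Sy); apply: sub_join_ub Sy.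
Qed.

(** The map out of [F] determined by maps [f i] out of the members of [A] is built
    as a relation: [glue l x t] says that [x] is a sum of elements of the members
    listed in [l], and [t] the corresponding sum of their images.  The lists may
    repeat members. *)
Section DirectSum.
Variables (F : presheaf) (A : subfunctor F -> Prop) (T : presheaf).
Notation member := {S : subfunctor F | A S}.
Variable f : forall i : member, natural (sub (sval i)) T.

Fixpoint glue (l : seq member) a (x : space F a) (t : space T a) : Prop :=
  if l is i :: l' then
    exists s, glue l' (x - at_ob (incl (sval i)) a s) (t - at_ob (f i) a s)
  else x = 0 /\ t = 0.

Lemma member_inj (i j : member) : sval i = sval j -> i = j.
Proof. by case: i j => i Ai [j Aj] /= ij; apply: eq_exist. Qed.

Lemma glue_cat l1 l2 a c (x y : space F a) t u :
  glue l1 x t -> glue l2 y u -> glue (l1 ++ l2) (c *: x + y) (c *: t + u).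
Proof.
elim: l1 x t => [|i l IH] x t /= => [[-> ->]|[s xt] yu].
  by rewrite !scaler0 !add0r.
exists (c *: s); rewrite (linearZ_LR (at_ob (f i) a)).
by have := IH _ _ xt yu; rewrite !scalerBr !(addrAC _ (- _)).
Qed.

Lemma glue_act l a b (h : hom a b) x t :
  glue l x t -> glue l (act F h x) (act T h t).
Proof.
elim: l x t => [|i l IH] x t /= => [[-> ->]|[s /IH]]; first by rewrite !linear0.
by exists (act (sub (sval i)) h s); rewrite !at_ob_nat -!linearB.
Qed.

(** An element of a member already listed is merged with the one recorded for it,
    which is how repetitions are dealt with. *)
Lemma glue_absorb l i a s (x : space F a) t : List.In i l ->
  glue l x t -> glue l (x - at_ob (incl (sval i)) a s) (t - at_ob (f i) a s).
Proof.
elim: l x t => [//|j l IH] x t /= [->|il] [r xt].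
  exists (r - s); have -> : fval (r - s) = fval r - fval s by [].
  by rewrite (linearB (at_ob (f i) a)) !opprB !addrA !subrK.
by exists r; rewrite addrAC [t - _ - _]addrAC; apply: IH.
Qed.

Lemma glue_mem l (J : subfunctor F) a (x : space F a) t :
  (forall i, List.In i l -> sub_le (sval i) J) -> glue l x t -> J a x.
Proof.
elim: l x t => [|i l IH] x t lJ /= => [[-> _]|[s xt]]; first exact: smem0.
rewrite -[x](subrK (at_ob (incl (sval i)) a s)); apply: smemD.
  by apply: IH xt => j jl; apply: lJ; right.
by apply: (lJ i) (inclP s); left.
Qed.

(** This makes the glued relation single-valued.  For the head [i] of the list,
    either [i] occurs again and is absorbed, or independence forces its
    component of [0] to vanish. *)
Lemma glue0 l a t : independent A -> @glue l a 0 t -> t = 0.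
Proof.
move=> AI; elim: l t => [t [] //|i l IH] t /= [s].
have [il|nil] := pselect (List.In i l).
  move=> /(glue_absorb (- s) il); rewrite !linearN !opprK !subrK.
  exact: IH.
rewrite sub0r => st; have s0 : s = 0.
  apply: incl_inj; rewrite linear0; apply: (AI _ (svalP i)); first exact: inclP.
  rewrite -[at_ob _ _ _]opprK -scaleN1r; apply: smemZ.
  apply: glue_mem st => j jl; apply: (@sub_join_ub _ _ _ (fun T => A T /\ T <> sval i)).
  split; first exact: svalP.
  by move=> /member_inj ji; apply: nil; rewrite -ji.
move: st; rewrite s0 (linear0 (at_ob (f i) a)) subr0 => st.
by apply: IH; rewrite -oppr0.
Qed.

Definition glue_dom : subfunctor F.
Proof.
refine (@mksub k C F (fun a x => exists l t, glue l x t) _ _ _).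
- by move=> a; exists [::], 0.
- move=> a c u v [l [t lt]] [l' [t' lt']]; exists (l ++ l'), (c *: t + t').
  exact: glue_cat.
- by move=> a b h x [l [t lt]]; exists l, (act T h t); apply: glue_act.
Defined.

End DirectSum.

Lemma independent_coproduct F (A : subfunctor F -> Prop) :
  independent A -> (forall a x, sub_join A a x) ->
  @is_coproduct psh {S : subfunctor F | A S} (fun i => sub (sval i)) F
    (fun i => incl (sval i)).
Proof.
move=> AI Atop T f.
have one (i : {S | A S}) a s :
    glue f [:: i] (at_ob (incl (sval i)) a s) (at_ob (f i) a s).
  by exists s; rewrite !subrr.
have domT a (x : space F a) : exists t l, glue f l x t.
  have [] : glue_dom f a x; last by move=> l [t lt]; exists t, l.
  move: (a) (x) (Atop a x); apply: sub_join_le => S AS b y Sy.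
  have [s <-] := incl_lift Sy.
  by exists [:: exist _ S AS], (at_ob (f (exist _ S AS)) b s); apply: one.
have uniq a (x : space F a) l l' t t' : glue f l x t -> glue f l' x t' -> t = t'.
  move=> lt lt'; have := glue_cat (-1) lt lt'.
  rewrite !scaleN1r addNr => /(glue0 AI)/eqP.
  by rewrite addrC subr_eq0 => /eqP.
pose u a x := sval (cid (domT a x)).
have uE a x l t : glue f l x t -> u a x = t.
  by rewrite /u; case: cid => t' [l' /= lt'] lt; apply: uniq lt' lt.
have uG a x : exists l, glue f l x (u a x) by rewrite /u; case: cid.
have uL a : linear (u a).
  move=> c x y; have [l lx] := uG a x; have [l' ly] := uG a y.
  exact: uE (glue_cat c lx ly).
have uN a b (h : hom a b) x : mklin (uL b) (act F h x) = act T h (mklin (uL a) x).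
  by have [l lx] := uG a x; apply: uE (glue_act h lx).
exists (mknat uN); split=> [i|v vE].
  by apply: nat_ext => a s; apply: uE (one i a s).
suff uv a x : equalizer (mknat uN) v a x by apply: nat_ext => a x; apply: uv.
move: (a) (x) (Atop a x); apply: sub_join_le => S AS b y Sy.
have [s <-] := incl_lift Sy => /=.
rewrite [LHS](uE _ _ _ _ (one (exist _ S AS) b s)).
by rewrite -(vE (exist _ S AS)).
Qed.

Lemma split_semisimple : is_split psh -> is_semisimple psh.
Proof.
move=> sp F; have [A [Am AI Atop]] := split_independent F sp.
exists {S : subfunctor F | A S}, (fun i => sub (sval i)), (fun i => incl (sval i)).
split; last exact: independent_coproduct.
by move=> i; apply/minimal_simple/Am/svalP.
Qed.

End Split.

(** * A groupoid with finite hom-sets gives a split category *)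

Section Averaging.
Variables (k : fieldType) (char_k0 : [pchar k] =i pred0).
(* Finiteness of the hom-sets is a bijection with finite types [E a b] rather
   than a structure on [hom a b], whose universe is too large for a [finType]. *)
Variables (C : category) (E : C -> C -> finType).
Variables (arr : forall a b, E a b -> hom a b) (idx : forall a b, hom a b -> E a b).
Hypotheses (arrK : forall a b, cancel (@arr a b) (@idx a b))
  (idxK : forall a b, cancel (@idx a b) (@arr a b)).
Notation psh := (functor_category C (Vect k)).
Hypothesis C_groupoid : is_groupoid C.

Let inv a b (f : hom a b) : hom b a := sval (cid (C_groupoid f)).

Let invK a b (f : hom a b) : inv f ∘ f = idm a.
Proof. by rewrite /inv; case: cid => g []. Qed.

Let invKV a b (f : hom a b) : f ∘ inv f = idm b.
Proof. by rewrite /inv; case: cid => g []. Qed.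

Let inv_comp a b c (g : hom b c) (f : hom a b) : f ∘ inv (g ∘ f) = inv g.
Proof.
have e : g ∘ (f ∘ inv (g ∘ f)) = idm c by rewrite compA invKV.
by rewrite -[LHS]comp1m -(invK g) -compA e compm1.
Qed.

Let precomp a b r (f : hom a b) (h : E b r) : E a r := idx (arr h ∘ f).

Let precomp_bij a b r (f : hom a b) : bijective (@precomp a b r f).
Proof.
exists (precomp (inv f)) => h; rewrite /precomp idxK -compA.
  by rewrite invKV compm1 arrK.
by rewrite invK compm1 arrK.
Qed.

Lemma groupoid_split : is_split psh.
Proof.
move=> X Y Z i p ex; have pS := short_exact_surj ex.
have [s0 ps0] : exists s : forall a, {linear space Z a -> space Y a},
    forall a z, at_ob p a (s a z) = z.
  exists (fun a => sval (cid (surj_section (pS a)))) => a.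
  by case: cid.
(* The mean over [g : a -> r] of the conjugates of the section at [r]. *)
pose avg r a z : space Y a :=
  #|E a r|%:R^-1 *: \sum_(g : E a r) act Y (inv (arr g)) (s0 r (act Z (arr g) z)).
have avgL r a : linear (avg r a).
  move=> c x y; rewrite /avg scalerA mulrC -scalerA -scalerDr; congr (_ *: _).
  by rewrite scaler_sumr -big_split; apply: eq_bigr => g _; rewrite !linearP.
have avgN r a b (f : hom a b) z : avg r b (act Z f z) = act Y f (avg r a z).
  rewrite /avg (linearZ_LR (act Y f)) (linear_sum (act Y f)).
  rewrite (bij_eq_card (precomp_bij r f)); congr (_ *: _).
  rewrite [RHS](reindex (precomp f)); last exact: onW_bij (precomp_bij r f).
  apply: eq_bigr => h _; rewrite /precomp idxK.
  by rewrite -[RHS]actM inv_comp actM.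
have avgK r a z (f : hom a r) : at_ob p a (avg r a z) = z.
  rewrite /avg (linearZ_LR (at_ob p a)) (linear_sum (at_ob p a)).
  rewrite (eq_bigr (fun _ => z)) => [|g _]; last first.
    by rewrite /= at_ob_nat ps0 -actM invK act1.
  rewrite sumr_const -scaler_nat scalerA mulVf ?scale1r //.
  by rewrite (proj1 (pcharf0P k) char_k0) -lt0n; apply/card_gt0P; exists (idx f).
have iso_refl (a : C) : exists r, isomorphic a r.
  by exists a, (idm a); apply: C_groupoid.
pose r a := sval (cid (iso_refl a)).
have ar a : isomorphic a (r a) by rewrite /r; case: cid.
(* The representative depends only on the class: isomorphic objects have equal
   predicates [isomorphic _], from which it is chosen. *)
have rE (a b : C) (f : hom a b) : r b = r a.
  rewrite /r; move: (iso_refl a) (iso_refl b).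
  have -> : isomorphic a = isomorphic b.
    apply: funext => c; apply/propext; split=> -[g _].
      by exists (g ∘ inv f); apply: C_groupoid.
    by exists (g ∘ f); apply: C_groupoid.
  by move=> P Q; rewrite (Prop_irrelevance P Q).
have sN a b (f : hom a b) z :
    mklin (avgL (r b) b) (act Z f z) = act Y f (mklin (avgL (r a) a) z).
  by rewrite (rE _ _ f) /= avgN.
exists (mknat sN); apply: nat_ext => a z.
by have [f _] := ar a; apply: avgK f.
Qed.

End Averaging.

(** * Semisimple implies groupoid *)

Section SimplePresheaves.
(* For the opposite of a category of groups and surjections, [deg] is the order
   of the group. *)
Variables (k : fieldType) (C : category) (deg : C -> nat).
Notation psh := (functor_category C (Vect k)).
Hypothesis deg_hom : forall a b (f : hom a b), (deg a <= deg b)%N.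

Definition above (F : psh) (n : nat) : subfunctor F.
Proof.
refine (@mksub k C F (fun a x => (n < deg a)%N \/ x = 0) _ _ _).
- by move=> a; right.
- move=> a c u v [na|->]; first by left.
  by case=> [na|->]; [left|right; rewrite scaler0 addr0].
- move=> a b f x [na|->]; last by right; rewrite linear0.
  by left; apply: leq_trans na (deg_hom f).
Defined.

(** In a simple [S] the elements in degrees above [deg a] form a subfunctor that is
    zero, so that [act S f x] vanishes, or everything, so that [x] does. *)
Lemma simple_act_small (S : psh) a b (f : hom a b) x :
  is_simple S -> (deg a < deg b)%N -> act S f x = 0.
Proof.
move=> [_ Smin] ab; pose L := above S (deg a).
have iM : @is_mono psh (sub L) S (incl L).
  move=> G u v e; apply: nat_ext => c y; apply: incl_inj.
  exact: (congr1 (fun t : natural G S => at_ob t c y) e).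
have [/is_zeroP L0|[j [_ ij]]] := Smin _ _ iM.
  have [y <-] : exists y, at_ob (incl L) b y = act S f x by apply: incl_lift; left.
  by rewrite (L0 b y) linear0.
have : L a x by rewrite -[x](at_ob_id (F := S)) -ij; apply: inclP.
by move=> [|->]; [rewrite ltnn|rewrite linear0].
Qed.

(** The largest subfunctor on which all degree-raising morphisms act by zero. *)
Definition inert (F : psh) : subfunctor F.
Proof.
refine (@mksub k C F (fun a x =>
  forall b (f : hom a b), (deg a < deg b)%N -> act F f x = 0) _ _ _).
- by move=> a b f _; rewrite linear0.
- by move=> a c u v u0 v0 b f ab; rewrite linearP u0 // v0 // scaler0 addr0.
- move=> a b h x x0 c f bc; rewrite -actM x0 //.
  exact: leq_ltn_trans (deg_hom h) bc.
Defined.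

(** [inert F] contains the image of each simple summand, so the universal property
    of the coproduct splits its inclusion into [F]. *)
Lemma semisimple_act_small (F : psh) a b (f : hom a b) x :
  is_semisimple_ob F -> (deg a < deg b)%N -> act F f x = 0.
Proof.
move=> [I [S [inj [Ssimple cop]]]] ab; pose K := inert F.
have SK i c y : K c (at_ob (inj i) c y).
  by move=> d g cd; rewrite -at_ob_nat (simple_act_small _ _ (Ssimple i) cd) linear0.
have [u [uE _]] := cop (sub K) (fun i => corestr (SK i)).
have [w [_ wU]] := cop F inj.
pose j : hom (sub K : psh) F := incl K.
have ju : j ∘ u = idm F.
  apply: etrans (esym (wU _ _)) (wU _ _) => i; last by rewrite comp1m.
  by rewrite -compA uE; apply: nat_ext.
have : K a x by rewrite -[x](at_ob_id (F := F)) -ju; apply: inclP.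
exact.
Qed.

(** The constant functor [k] is a test object: all morphisms act on it by the
    identity, which is not zero. *)
Lemma semisimple_deg a b (f : hom a b) : is_semisimple psh -> deg a = deg b.
Proof.
move=> ss; pose F : psh := @mkpresheaf k C (fun _ => k^o) (fun _ _ _ => idfun)
    (fun _ _ => erefl) (fun _ _ _ _ _ _ => erefl).
apply/eqP; rewrite eqn_leq deg_hom // leqNgt; apply/negP => ab.
have /eqP := @semisimple_act_small F a b f (1 : k) (ss F) ab.
by rewrite /= oner_eq0.
Qed.

End SimplePresheaves.

(** * Surjections of finite groups *)

Section Groups.
Local Open Scope group_scope.

Lemma surj_card_codom (G H : finGroupType) (f : {ffun G -> H}) :
  f \in surj_homs G H -> #|codom f| = #|H|.
Proof.
move=> /surj_homsP[_ fS]; apply: eq_card => y.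
by have [x <-] := fS y; rewrite codom_f.
Qed.

Lemma out_hom_card (G H : finGroupType) (A : out_hom G H) : (#|H| <= #|G|)%N.
Proof.
have /imsetP[f fS _] := svalP A.
by rewrite -(surj_card_codom fS) leq_image_card.
Qed.

Lemma eq_card_is_iso (G H : finGroupType) (A : out_hom G H) :
  #|G| = #|H| -> @is_iso FinGrp G H A.
Proof.
move=> GH; have /imsetP[f fS eA] := svalP A; have /surj_homsP[fM _] := fS.
have injf : injective f.
  have /image_injP injf : #|image f G| == #|G| by rewrite (surj_card_codom fS) GH.
  by move=> x y; apply: injf.
have [g fK gK] := inj_card_bij injf (eq_leq (esym GH)).
have gM : {morph [ffun y => g y] : x y / x * y}.
  by move=> x y; apply: injf; rewrite !ffunE fM !gK.
have gS : is_hom_class (conj_class [ffun y => g y]).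
  apply/imset_f/surj_homsP; split=> // x.
  by exists (f x); rewrite ffunE fK.
exists (exist (@is_hom_class H G) _ gS); split; apply: val_inj;
  rewrite /= eA class_compE //; congr conj_class; apply/ffunP => x.
  by rewrite !ffunE fK.
by rewrite !ffunE gK.
Qed.

End Groups.

Theorem proposition6p3 (k : fieldType) (char_k0 : [pchar k]%R =i pred0)
    (U : subcategory FinGrp) :
  [<-> is_groupoid U;
       is_split (presheaves k U);
       is_semisimple (presheaves k U)].
Proof.
tfae=> [Ugrpd||ss G H A].
- have opU : is_groupoid (opposite U).
    by move=> G H A; have [B [BA AB]] := Ugrpd _ _ A; exists B.
  exact: (@groupoid_split k char_k0 (opposite U)
    (fun G H => out_hom (sval H) (sval G))
    (fun _ _ A => A) (fun _ _ A => A) (fun _ _ _ => erefl) (fun _ _ _ => erefl)).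
- exact: split_semisimple.
- apply/eq_card_is_iso/esym.
  exact: (@semisimple_deg k (opposite U) (fun G => #|sval G|)
    (fun _ _ B => out_hom_card B) H G A ss).
Qed.
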